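(* Let the random vectors $\zeta\in\mathbb{R}^N$ and $\xi\in\mathbb{R}^m$ satisfy $\mathbb{E}[\zeta^i]=1$ for all $i=1:N$, and $\xi\ge 0$ with $\mathbb{E}[\xi^j]>0$ for all $j=1:m$. Then the deterministic problem $$\min_{x\in\mathcal{Y}} \; F(x)=\frac1N\sum_{i=1}^N (f_i(x)+g_i(x))\quad\text{subject to } h_j(x)\le 0\ \ \forall j=1:m$$ is equivalent to the stochastic problem $$\min_{x\in\mathcal{Y}} \; \mathbb{E}[f(x,\zeta)+g(x,\zeta)]\quad\text{subject to } h(x,\xi)\le 0\ \text{ for every realization of } \xi ,$$ i.e., the two problems have the same objective function and the same feasible set.
   Context: $\mathcal{Y}\subseteq\mathbb{R}^n$ is a nonempty closed convex set; $f_i,g_i$ ($i=1:N$) and $h_j$ ($j=1:m$) are proper lower semicontinuous convex functions on $\mathbb{R}^n$ whose effective domains contain the interior of $\mathcal{Y}$, and all the $g_i$ have a common domain. The notation $i=1:N$ means $i\in\{1,\dots,N\}$. The random vectors $\zeta$ (with components $\zeta^1,\dots,\zeta^N$) and $\xi$ (with components $\xi^1,\dots,\xi^m$) are drawn from probability distributions $\mathbb{P}_1$ and $\mathbb{P}_2$ on finite probability spaces; $\xi$ is bounded, $0\le \xi^j\le\bar\xi<\infty$. Define $$f(x,\zeta)=\frac1N\sum_{i=1}^N\zeta^i f_i(x),\qquad g(x,\zeta)=\frac1N\sum_{i=1}^N\zeta^i g_i(x),\qquad h(x,\xi)=\max_{j=1:m}\big(\xi^j h_j(x)\big).$$ *)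

(* Defs.v *)
From HB Require Import structures.
From mathcomp Require Import all_boot all_order all_algebra.
From mathcomp Require Import all_classical all_reals all_analysis.
Import Order.TTheory GRing.Theory Num.Theory.
Import numFieldNormedType.Exports.

Set Implicit Arguments.
Unset Strict Implicit.
Unset Printing Implicit Defensive.

Local Open Scope classical_set_scope.
Local Open Scope ring_scope.

(* Convention for extended-real sums: the components of zeta may be negative
   while f_i and g_i may take the value +oo, so oo - oo can occur off the
   domains. As usual for minimization problems, every sum below is the upper
   sum, with (+oo) + (-oo) = +oo: this is the addition of the library's [%dE]
   scope (the addition of [%E] has the opposite convention). Products satisfy
   0 * (+oo) = 0. *)

Definition dom (T : Type) (R : realType) (f : T -> \bar R) : set T :=
  [set x | (f x < +oo)%E].

Definition proper (T : Type) (R : realType) (f : T -> \bar R) : Prop :=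
  (forall x, (-oo < f x)%E) /\ dom f !=set0.

(* Meant for functions that never take the value -oo, so that the right-hand
   side is not an indeterminate form. *)
Definition econvex_function (R : realType) (E : lmodType R) (f : E -> \bar R) :
    Prop :=
  forall (x y : E) (t : R), 0 < t -> t < 1 ->
    (f (t *: x + (1 - t) *: y)%R <= t%:E * f x + (1 - t)%:E * f y)%E.

Definition proper_lsc_convex (R : realType) (n : nat)
    (f : 'rV[R]_n -> \bar R) : Prop :=
  [/\ proper f, lower_semicontinuous f & econvex_function f].

Definition weighted_avg (T : Type) (R : realType) (N : nat)
    (f : 'I_N -> T -> \bar R) (x : T) (z : 'I_N -> R) : \bar R :=
  ((N%:R^-1)%:E * \sum_(i < N) ((z i)%:E * f i x))%dE.

Definition weighted_max (T : Type) (R : realType) (m : nat)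
    (h : 'I_m -> T -> \bar R) (x : T) (y : 'I_m -> R) : \bar R :=
  (\big[maxe/-oo]_(j < m) ((y j)%:E * h j x))%E.

(* The library integral of an extended-real function is the difference of the
   integrals of its positive and negative parts, with oo - oo = -oo; here the
   difference is the upper one, so the two agree unless both parts have an
   infinite integral. *)
Definition upper_expectation (d : measure_display) (T : measurableType d)
    (R : realType) (P : probability T R) (Z : T -> \bar R) : \bar R :=
  ((\int[P]_w (Z^\+ w))%E - (\int[P]_w (Z^\- w))%E)%dE.

(* "Minimize [objective] over [feasible_set]"; the ambient constraint x \in Y
   is part of the feasible set. *)
Record min_problem (R : realType) (T : Type) := MinProblem {
  objective : T -> \bar R ;
  feasible_set : set T }.

Definition equivalent_problems (R : realType) (T : Type)
    (p q : min_problem R T) : Prop :=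
  (forall x, objective p x = objective q x) /\
  feasible_set p = feasible_set q.

Definition deterministic_problem (R : realType) (n N m : nat)
    (Y : set 'rV[R]_n) (f g : 'I_N -> 'rV[R]_n -> \bar R)
    (h : 'I_m -> 'rV[R]_n -> \bar R) : min_problem R 'rV[R]_n :=
  MinProblem
    (fun x => ((N%:R^-1)%:E * \sum_(i < N) (f i x + g i x))%dE)
    [set x | Y x /\ forall j, (h j x <= 0)%E].

Definition stochastic_problem (R : realType) (n N m : nat)
    (Y : set 'rV[R]_n) (f g : 'I_N -> 'rV[R]_n -> \bar R)
    (h : 'I_m -> 'rV[R]_n -> \bar R)
    (d1 d2 : measure_display) (T1 : measurableType d1) (T2 : measurableType d2)
    (P1 : probability T1 R) (P2 : probability T2 R)
    (zeta : 'I_N -> {RV P1 >-> R}) (xi : 'I_m -> {RV P2 >-> R}) :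
    min_problem R 'rV[R]_n :=
  MinProblem
    (fun x => upper_expectation P1 (fun w =>
       (weighted_avg f x (fun i => zeta i w) +
        weighted_avg g x (fun i => zeta i w))%dE))
    [set x | Y x /\
       forall w : T2, (weighted_max h x (fun j => xi j w) <= 0)%E].

(* Main.v *)
Require Import Defs.
From HB Require Import structures.
From mathcomp Require Import all_boot all_order all_algebra.
From mathcomp Require Import all_classical all_reals all_analysis.
From mathcomp Require Import measurable_realfun.
Import Order.TTheory GRing.Theory Num.Theory.
Import numFieldNormedType.Exports.

Local Open Scope classical_set_scope.
Local Open Scope ring_scope.

Import DualAddTheory.

(** Feasible sets. The constraint [h(x, xi) <= 0] for every outcome says that
    [xi^j h_j(x) <= 0] for all [j] and all outcomes. Since [xi^j >= 0], it
    follows from [h_j(x) <= 0]; conversely [E xi^j > 0] yields an outcome with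
    [xi^j > 0] ([exists_gt0]), and there the weight can be divided out.

    Objectives. As neither [f_i] nor [g_i] takes the value -oo, the two
    weighted averages merge into one, with [phi_i = f_i + g_i]
    ([weighted_avgD]), and it remains to see that the expectation of
    [N^-1 sum_i zeta^i phi_i(x)] is [N^-1 sum_i phi_i(x)]
    ([upper_expectation_weighted_avg]). If every [phi_i(x)] is finite, this is
    linearity of the integral together with [E zeta^i = 1]. If some [phi_i(x)]
    is +oo, the right-hand side is +oo; on the left, the upper sum is +oo
    wherever [zeta^i > 0], whatever the other terms are. Because
    [E zeta^i > 0], this happens with positive probability, so the positive
    part has an infinite integral, and the upper expectation is +oo even when
    the negative part, coming from negative weights, has an infinite integral
    too ([upper_expectation_pinfty]). *)

(** * Upper sums and weighted averages *)

Lemma dadde_gtNy (R : realType) (x y : \bar R) :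
  (-oo < x)%E -> (-oo < y)%E -> (-oo < (x + y)%dE)%E.
Proof. by case: x y => [r||] [s||] //= _ _; rewrite -dEFinD ltNyr. Qed.

(** Distributivity holds for a scalar of any sign: with both terms above -oo,
    a negative scalar sends every infinite term to the same -oo. *)
Lemma mule_dadde (R : realType) (a : R) (x y : \bar R) :
  (-oo < x)%E -> (-oo < y)%E ->
  (a%:E * (x + y) = a%:E * x + a%:E * y)%dE.
Proof.
move=> x_gtNy y_gtNy; apply: dmuleDr => //.
by rewrite /adde_def; case: x x_gtNy; case: y y_gtNy.
Qed.

(** A positive scalar preserves the upper sum also when its terms are opposite
    infinities, as partial averages with weights of mixed signs may be. *)
Lemma pmule_dadde (R : realType) (a : R) (x y : \bar R) : 0 < a ->
  (a%:E * (x + y) = a%:E * x + a%:E * y)%dE.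
Proof.
move=> a_gt0.
have [->|x_neqy] := eqVneq x +oo%E; first by rewrite daddye gt0_muley// daddye.
have [->|y_neqy] := eqVneq y +oo%E; first by rewrite daddey gt0_muley// daddey.
by rewrite dmuleDr// /adde_def (negbTE x_neqy) (negbTE y_neqy) andbF.
Qed.

Lemma weighted_avgD (T : Type) (R : realType) (N : nat)
    (f g : 'I_N -> T -> \bar R) (x : T) (z : 'I_N -> R) :
  (0 < N)%N ->
  (forall i, -oo < f i x)%E -> (forall i, -oo < g i x)%E ->
  (weighted_avg f x z + weighted_avg g x z)%dE =
  weighted_avg (fun i y => (f i y + g i y)%dE) x z.
Proof.
move=> N_gt0 f_gtNy g_gtNy.
rewrite /weighted_avg -pmule_dadde ?invr_gt0 ?ltr0n//; congr (_ * _)%E.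
rewrite -big_split /=; apply: eq_bigr => i _.
by rewrite mule_dadde.
Qed.

(** +oo absorbs everything in an upper sum, so the other terms may be -oo. *)
Lemma weighted_avg_pinfty (T : Type) (R : realType) (N : nat)
    (phi : 'I_N -> T -> \bar R) (x : T) (z : 'I_N -> R) (i : 'I_N) :
  0 < z i -> phi i x = +oo%E -> weighted_avg phi x z = +oo%E.
Proof.
move=> zi_gt0 phi_y; have N_gt0 : (0 < N)%N by exact: leq_ltn_trans (ltn_ord i).
rewrite /weighted_avg (_ : bigop _ _ _ = +oo%E).
  by rewrite gt0_muley// lte_fin invr_gt0 ltr0n.
apply/desum_eqyP; exists i; split => //.
by rewrite phi_y gt0_muley.
Qed.

(** * Integrals and upper expectations *)

(** The integral of a nonnegative function is a supremum over the simple
    functions below it, hence monotone without any measurability of the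
    functions. *)
Lemma le_integral_nonneg (d : measure_display) (T : measurableType d)
    (R : realType) (mu : {measure set T -> \bar R}) (u v : T -> \bar R) :
  (forall w, 0 <= u w)%E -> (forall w, u w <= v w)%E ->
  (\int[mu]_w u w <= \int[mu]_w v w)%E.
Proof.
move=> u_ge0 uv.
have v_ge0 w : (0 <= v w)%E by exact: le_trans (uv w).
rewrite !ge0_integralE// !patch_setT.
by apply: le_ereal_sup => _ [k ku <-]; exists k => // w; exact: le_trans (uv w).
Qed.

Lemma integral_funepos_gt0 (d : measure_display) (T : measurableType d)
    (R : realType) (P : probability T R) (X : {RV P >-> R}) :
  (0 < 'E_P[X])%E -> (0 < \int[P]_w ((EFin \o X)^\+ w))%E.
Proof.
rewrite expectation_def integralE => /lt_le_trans; apply.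
by rewrite geeDl// oppe_le0 integral_ge0.
Qed.

Lemma exists_gt0 (d : measure_display) (T : measurableType d)
    (R : realType) (P : probability T R) (X : {RV P >-> R}) :
  (0 < 'E_P[X])%E -> exists w, 0 < X w.
Proof.
move=> EX_gt0; apply: contrapT => /forallNP X_le0.
move/integral_funepos_gt0: EX_gt0; apply/negP; rewrite -leNgt.
rewrite integral0_eq// => w _; rewrite funeposE max_r// lee_fin leNgt.
exact/negP/X_le0.
Qed.

(** With oo - oo = -oo, the integral is finite only if both the positive and
    the negative part have a finite integral. *)
Lemma integrable_RV (d : measure_display) (T : measurableType d)
    (R : realType) (P : probability T R) (X : {RV P >-> R}) :
  'E_P[X]%E \is a fin_num -> P.-integrable setT (EFin \o X).
Proof.
move=> EX_fin; apply/integrableP; split; first exact/measurable_EFinP.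
apply/abse_integralP => //; first exact/measurable_EFinP.
by rewrite -expectation_def ltey_eq abse_fin_num EX_fin.
Qed.

Lemma upper_expectation_integrable (d : measure_display) (T : measurableType d)
    (R : realType) (P : probability T R) (Z : T -> \bar R) :
  P.-integrable setT Z ->
  upper_expectation P Z = (\int[P]_w Z w)%E.
Proof.
move=> Z_int; rewrite /upper_expectation [RHS]integralE dual_addeE_def//.
by rewrite fin_num_adde_defr ?integrable_pos_fin_num.
Qed.

(** The positive part of [Z] dominates [+oo * X^+], whose integral is
    [+oo * E(X^+) = +oo]. *)
Lemma upper_expectation_pinfty (d : measure_display) (T : measurableType d)
    (R : realType) (P : probability T R) (X : {RV P >-> R}) (Z : T -> \bar R) :
  (0 < 'E_P[X])%E -> (forall w, 0 < X w -> Z w = +oo%E) ->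
  upper_expectation P Z = +oo%E.
Proof.
move=> EX_gt0 Z_y; rewrite /upper_expectation.
suff -> : (\int[P]_w (Z^\+ w))%E = +oo%E by rewrite daddye.
apply/eqP; rewrite -leye_eq.
have <- : (\int[P]_w (+oo * (EFin \o X)^\+ w) = +oo)%E.
  rewrite ge0_integralZl//; last exact/measurable_funepos/measurable_EFinP.
  by rewrite gt0_mulye// integral_funepos_gt0.
apply: le_integral_nonneg => w; first by rewrite mule_ge0.
have [Xw_gt0|Xw_le0] := ltP 0 (X w).
  by rewrite funeposE [in leRHS]funeposE Z_y// leey.
by rewrite funeposE /= max_r ?lee_fin// mule0.
Qed.

Lemma upper_expectation_weighted_avg (d : measure_display)
    (S : measurableType d) (R : realType) (P : probability S R)
    (T : Type) (N : nat) (phi : 'I_N -> T -> \bar R) (x : T)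
    (zeta : 'I_N -> {RV P >-> R}) :
  (0 < N)%N ->
  (forall i, -oo < phi i x)%E -> (forall i, 'E_P[zeta i] = 1)%E ->
  upper_expectation P (fun w => weighted_avg phi x (fun i => zeta i w)) =
  ((N%:R^-1)%:E * \sum_(i < N) phi i x)%dE.
Proof.
move=> N_gt0 phi_gtNy E_zeta.
have [[i phi_y]|phi_fin] := pselect (exists i, phi i x = +oo%E).
  rewrite (@upper_expectation_pinfty _ _ _ _ (zeta i)) ?E_zeta//; last first.
    by move=> w zeta_gt0; exact: (@weighted_avg_pinfty _ _ _ _ _ _ i).
  rewrite (_ : bigop _ _ _ = +oo%E).
    by rewrite gt0_muley// lte_fin invr_gt0 ltr0n.
  by apply/desum_eqyP; exists i; split.
have phiE i : phi i x = (fine (phi i x))%:E.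
  rewrite fineK// fin_real// phi_gtNy ltey /=.
  by apply/eqP => phi_y; apply: phi_fin; exists i.
have zeta_int i :
    P.-integrable setT (fun w => (fine (phi i x))%:E * (zeta i w)%:E)%E.
  by apply: integrableZl => //; apply: integrable_RV; rewrite E_zeta.
have -> : (fun w => weighted_avg phi x (fun i => zeta i w)) =
    (fun w => (N%:R^-1)%:E *
       \sum_(i < N) ((fine (phi i x))%:E * (zeta i w)%:E))%E.
  apply/funext => w; rewrite /weighted_avg; congr (_ * _)%E.
  under eq_bigr do rewrite phiE -EFinM mulrC.
  by rewrite dsumEFin sumEFin.
rewrite upper_expectation_integrable; last first.
  by apply: integrableZl => //; exact: integrable_sum.
rewrite integralZl//; last exact: integrable_sum.
rewrite integral_sum//; congr (_ * _)%E.
under [RHS]eq_bigr do rewrite phiE.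
rewrite dsumEFin -sumEFin; apply: eq_bigr => i _.
rewrite integralZl//; last by apply: integrable_RV; rewrite E_zeta.
by rewrite -expectation_def E_zeta mule1.
Qed.

(** * Constraints and the equivalence *)

Lemma weighted_max_le0 (T : Type) (R : realType) (m : nat)
    (h : 'I_m -> T -> \bar R) (x : T) (y : 'I_m -> R) :
  (weighted_max h x y <= 0)%E <-> forall j, ((y j)%:E * h j x <= 0)%E.
Proof.
split=> [/bigmax_leP[_ le0] j|le0]; first exact: le0.
by apply/bigmax_leP; split; rewrite ?leNye.
Qed.

Theorem lemma3p1 (R : realType) (n N m : nat) (hN : (0 < N)%N)
  (Y : set 'rV[R]_n)
  (Y_nonempty : Y !=set0) (Y_closed : closed Y) (Y_convex : convex_set Y)
  (f g : 'I_N -> 'rV[R]_n -> \bar R) (h : 'I_m -> 'rV[R]_n -> \bar R)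
  (hf : forall i, proper_lsc_convex (f i) /\ interior Y `<=` dom (f i))
  (hg : forall i, proper_lsc_convex (g i) /\ interior Y `<=` dom (g i))
  (hh : forall j, proper_lsc_convex (h j) /\ interior Y `<=` dom (h j))
  (g_dom : forall i i', dom (g i) = dom (g i'))
  (d1 d2 : measure_display) (T1 : measurableType d1) (T2 : measurableType d2)
  (T1_finite : finite_set [set: T1]) (T2_finite : finite_set [set: T2])
  (P1 : probability T1 R) (P2 : probability T2 R)
  (zeta : 'I_N -> {RV P1 >-> R}) (xi : 'I_m -> {RV P2 >-> R})
  (E_zeta : forall i, ('E_P1[zeta i] = 1)%E)
  (xibar : R) (xi_bounded : forall j w, 0 <= xi j w <= xibar)
  (E_xi : forall j, (0 < 'E_P2[xi j])%E) :
  equivalent_problems (deterministic_problem Y f g h)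
                      (stochastic_problem Y f g h zeta xi).
Proof.
have finite_below (phi : 'rV[R]_n -> \bar R) x :
    proper_lsc_convex phi -> (-oo < phi x)%E by case=> -[].
have f_gtNy i x : (-oo < f i x)%E by apply: finite_below; case: (hf i).
have g_gtNy i x : (-oo < g i x)%E by apply: finite_below; case: (hg i).
split=> [x /=|].
  under [in RHS]eq_fun => w do
    rewrite (weighted_avgD _ _ _ _ _ _ _ hN (f_gtNy^~ x) (g_gtNy^~ x)).
  rewrite upper_expectation_weighted_avg// => i.
  exact: dadde_gtNy.
apply/seteqP; split=> x /= [Yx h_le0]; split=> //.
  move=> w; apply/weighted_max_le0 => j.
  by apply: mule_ge0_le0 => //; case/andP: (xi_bounded j w).
move=> j; have [w xi_gt0] := exists_gt0 _ _ _ _ _ (E_xi j).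
have /weighted_max_le0/(_ j) := h_le0 w.
by rewrite pmule_rle0.
Qed.
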